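(* Let $m>2$ and $n\ge 0$ be integers. The parameterized family of games random-orientation-generalized-rock-paper-scissors-with-duds with parameters $m,n$ (where the permutation $f$ is unknown to player 1) is guaranteed BL-WoLF-learnable with loss $1$; if $n=0$, it is guaranteed BL-WoLF-learnable with loss $0$.
   Context: Stage game. There are two players, player 1 (the learner) and player 2 (the opponent), with finite action sets $A_1, A_2$. Each pair of actions determines (deterministically, or through a probability distribution) a pair of utilities; the game is zero-sum (the utilities sum to a constant). A stage-game strategy for player $i$ is a probability distribution over $A_i$. The value $V$ of the game is $V=\max_{\sigma_1}\min_{\sigma_2}E[u_1\mid\sigma_1,\sigma_2]$, and $\sigma_1$ is a maximin strategy for player 1 if it guarantees player 1 expected utility at least $V$ against every $\sigma_2$. Repeated game. A parameterized family of stage games consists of fixed action sets $A_1,A_2$, a parameter set $K$, and a map sending each $k\in K$ to a zero-sum stage game with these action sets. One $k \in K$ is fixed, and the corresponding stage game is played over and over (random payoffs being drawn independently each round). Player 2 knows $k$ and player 1's learning strategy; player 1 knows only the family. After each round player 1 observes both actions and the payoffs. A learning strategy for player 1 prescribes a stage-game strategy for each history of past actions and payoffs; the opponent may likewise use any history-dependent strategy. Player 1's loss in a round is $V$ (the value of the actual stage game) minus the utility player 1 received in that round; the loss incurred over several rounds is the sum of the losses of those rounds. Guaranteed BL-WoLF-learnability. A parameter value is consistent with a history if that history's observed payoffs have positive probability under it given the actions. Player 1 has learned enough to construct a maximin strategy once there is a single stage-game strategy of player 1 that is a maximin strategy in every game of the family consistent with the history so far. A family is guaranteed BL-WoLF-learnable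 with loss $l$ if there exists a learning strategy for player 1 such that, for any game in the family and against any opponent, the cumulative loss incurred by player 1 before learning enough about the game to construct a maximin strategy (that is, at any time up to and including the round in which this is learned, or at all times if it is never learned) is never more than $l$ (for every possible realization of the randomness). The family random-orientation-generalized-rock-paper-scissors-with-duds. For given $m>2$ and $n$ (known to both players), both players have action set $A=\{1,2,\ldots,m+n\}$. The game is determined by a permutation $f:\{1,\ldots,m+n\}\to\{1,\ldots,m+n\}$ (the unknown parameter). The set of duds is $\{i: m+1\le f(i)\le m+n\}$. Each round, Nature flips a fair coin. Given actions $a_1,a_2$ (and writing $-i$ for the player other than $i$): if exactly one player plays a dud, that player loses; if neither player plays a dud, then with probability $\tfrac12$ the rule is that player $i$ wins if $f(a_i)\equiv f(a_{-i})+1\pmod m$, and with the remaining probability $\tfrac12$ the rule is that player $i$ wins if $f(a_i)\equiv f(a_{-i})-1\pmod m$; in any other case there is a draw. Winning gives utility $1$, losing gives utility $-1$, a draw gives utility $0$ to both. Player 1 initially does not know $f$. *)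

(* Defs.v *)
From mathcomp Require Import all_boot all_order all_algebra.
From mathcomp Require Import perm.
From mathcomp Require Import boolp classical_sets reals.

Set Implicit Arguments.
Unset Strict Implicit.
Unset Printing Implicit Defensive.

Import Order.TTheory GRing.Theory Num.Theory.

Local Open Scope ring_scope.

Record dist (R : realType) (T : finType) := Dist {
  pr :> {ffun T -> R};
  pr_ge0 : forall x, 0 <= pr x;
  pr_sum1 : \sum_x pr x = 1 }.

(* Random payoffs are functions of the actions and of a finite random state
   [nature], drawn afresh in every round.  The players observe the payoffs but
   not the state. *)
Record stage_game (R : realType) (A1 A2 : finType) := StageGame {
  nature : finType;
  nature_dist : dist R nature;
  payoffs : A1 -> A2 -> nature -> R * R;
  zero_sum : exists c, forall a1 a2 w,
    (payoffs a1 a2 w).1 + (payoffs a1 a2 w).2 = c }.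

Arguments payoffs {R A1 A2} s.

Section StageGame.
Context {R : realType} {A1 A2 : finType}.
Implicit Types (G : stage_game R A1 A2) (sigma : dist R A1) (tau : dist R A2).

Definition expected_u1 G sigma tau : R :=
  \sum_(a1 : A1) \sum_(a2 : A2) \sum_(w : nature G)
    sigma a1 * tau a2 * nature_dist G w * (payoffs G a1 a2 w).1.

(* The strategy spaces are compact and the expected utility is bilinear, so
   both extrema are attained: this is max min. *)
Definition value G : R :=
  sup (range (fun sigma => inf (range (expected_u1 G sigma)))).

Definition maximin G sigma : Prop :=
  forall tau, value G <= expected_u1 G sigma tau.

Definition payoff_prob G (a1 : A1) (a2 : A2) (u : R * R) : R :=
  \sum_(w : nature G | payoffs G a1 a2 w == u) nature_dist G w.

End StageGame.

Record round (R : realType) (A1 A2 : finType) := Round {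
  action1 : A1;
  action2 : A2;
  observed : R * R }.

(* Chronological: the latest round comes last. *)
Definition history (R : realType) (A1 A2 : finType) := seq (round R A1 A2).

Definition family (R : realType) (A1 A2 : finType) (K : Type) :=
  K -> stage_game R A1 A2.

Section RepeatedGame.
Context {R : realType} {A1 A2 : finType}.
Implicit Types (G : stage_game R A1 A2) (h : history R A1 A2).

(* [possible G S1 S2 h]: [h] has positive probability when [G] is repeated and
   the players use the behavior strategies [S1] and [S2]. *)
Inductive possible G (S1 : history R A1 A2 -> dist R A1)
    (S2 : history R A1 A2 -> dist R A2) : history R A1 A2 -> Prop :=
| possible_nil : possible G S1 S2 [::]
| possible_rcons h a1 a2 u :
    possible G S1 S2 h ->
    0 < S1 h a1 -> 0 < S2 h a2 -> 0 < payoff_prob G a1 a2 u ->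
    possible G S1 S2 (rcons h (Round a1 a2 u)).

Definition consistent G h : Prop :=
  0 < \prod_(r <- h) payoff_prob G (action1 r) (action2 r) (observed r).

Definition loss G h : R := \sum_(r <- h) (value G - (observed r).1).

Definition learned_enough (K : Type) (F : family R A1 A2 K) h : Prop :=
  exists sigma : dist R A1,
    forall k, consistent (F k) h -> maximin (F k) sigma.

(* The loss is bounded after every play none of whose proper prefixes has
   learned enough, so the round in which player 1 learns enough is counted. *)
Definition guaranteed_BL_WoLF_learnable (K : Type) (F : family R A1 A2 K)
    (l : R) : Prop :=
  exists S1 : history R A1 A2 -> dist R A1,
    forall (k : K) (S2 : history R A1 A2 -> dist R A2) h,
      possible (F k) S1 S2 h ->
      (forall t, (t < size h)%N -> ~ learned_enough F (take t h)) ->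
      loss (F k) h <= l.

End RepeatedGame.

Lemma fair_coin_ge0 (R : realType) (b : bool) :
  0 <= [ffun _ : bool => 2^-1 : R] b.
Proof. by rewrite ffunE invr_ge0 ler0n. Qed.

Lemma fair_coin_sum1 (R : realType) :
  \sum_(b : bool) [ffun _ : bool => 2^-1 : R] b = 1.
Proof.
rewrite big_bool /= !ffunE -mulr2n -(mulr_natr (2^-1)).
by rewrite mulVf // pnatr_eq0.
Qed.

Definition fair_coin (R : realType) : dist R bool :=
  Dist (@fair_coin_ge0 R) (@fair_coin_sum1 R).

(* The set {1, ..., m + n} is shifted to 'I_(m + n) = {0, ..., m + n - 1}, for
   actions and for values of [f]. *)
Section RockPaperScissorsWithDuds.
Variables (R : realType) (m n : nat).
Notation action := 'I_(m + n).
Implicit Types (f : {perm action}) (a b : action).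

Definition dud f a : bool := (m <= f a)%N.

(* [wins f c a b]: playing [a] wins against [b] when the coin shows [c].  Both
   players are judged with the same coin; "f a is f b - 1" is written
   "f a + 1 is f b" because subtraction on nat is truncated. *)
Definition wins f (c : bool) a b : bool :=
  if dud f a || dud f b then ~~ dud f a && dud f b
  else if c then (f a == f b + 1 %[mod m])%N
  else (f a + 1 == f b %[mod m])%N.

(* For m > 2 the two players never both win. *)
Definition rps_utility f (c : bool) a b : R :=
  (wins f c a b)%:R - (wins f c b a)%:R.

Definition rps_payoffs f a b (c : bool) : R * R :=
  (rps_utility f c a b, rps_utility f c b a).

Lemma rps_zero_sum f : exists c, forall a b w,
  (rps_payoffs f a b w).1 + (rps_payoffs f a b w).2 = c.
Proof. by exists 0 => a b w; rewrite /= /rps_utility addrA subrK subrr. Qed.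

Definition rps_with_duds : family R action action {perm action} :=
  fun f => StageGame (fair_coin R) (rps_zero_sum f).

End RockPaperScissorsWithDuds.

Arguments rps_with_duds : clear implicits.

(* Main.v *)
(** Against a fixed pair of non-duds the coin makes the expected payoff 0, so
    the expected payoff of player 1 is the probability that player 2 plays a dud
    minus the probability that player 1 does.  Hence the value is 0 and every
    non-dud is a maximin strategy.  The winner of a decisive round has played a
    non-dud, in plain view of player 1; so before the first decisive round
    player 1 loses nothing, and that round, which costs at most 1, teaches
    enough.  Any learning strategy therefore works.  Without duds, every strategy
    is maximin and nothing has to be learned. *)

Require Import Defs.
From mathcomp Require Import all_boot all_order all_algebra.
From mathcomp Require Import reals.
From mathcomp Require Import perm boolp classical_sets.

Set Implicit Arguments.
Unset Strict Implicit.
Unset Printing Implicit Defensive.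

Import Order.TTheory GRing.Theory Num.Theory.

Local Open Scope ring_scope.

Section Dirac.
Context {R : realType} {T : finType}.

Lemma dirac_ge0 (x y : T) : 0 <= [ffun z => (z == x)%:R : R] y.
Proof. by rewrite ffunE ler0n. Qed.

Lemma dirac_sum1 (x : T) : \sum_y [ffun z => (z == x)%:R : R] y = 1.
Proof.
rewrite (bigD1 x) //= ffunE eqxx big1 ?addr0 // => y /negPf yx.
by rewrite ffunE yx.
Qed.

Definition dirac (x : T) : dist R T := Dist (dirac_ge0 x) (dirac_sum1 x).

Lemma sum_dirac (x : T) (g : T -> R) : \sum_y dirac x y * g y = g x.
Proof.
rewrite (bigD1 x) //= ffunE eqxx mul1r big1 ?addr0 // => y /negPf yx.
by rewrite ffunE yx mul0r.
Qed.

End Dirac.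

Section PayoffProb.
Context {R : realType} {A1 A2 : finType}.
Implicit Types (G : stage_game R A1 A2) (h : history R A1 A2).

Lemma payoff_prob_ge0 G a1 a2 u : 0 <= payoff_prob G a1 a2 u.
Proof. by apply: sumr_ge0 => w _; apply: pr_ge0. Qed.

Lemma payoff_prob_gt0 G a1 a2 u :
  0 < payoff_prob G a1 a2 u -> exists w, payoffs G a1 a2 w = u.
Proof.
move=> u_gt0; have [[w /eqP wu]|no_w] :=
  pselect (exists w, payoffs G a1 a2 w == u); first by exists w.
move: u_gt0; rewrite /payoff_prob big_pred0 ?ltxx // => w.
by apply/negP => wu; apply: no_w; exists w.
Qed.

(** The last factor is nonnegative, and if it vanished so would the product. *)
Lemma consistent_rcons G h r : consistent G (rcons h r) ->
  0 < payoff_prob G (action1 r) (action2 r) (observed r).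
Proof.
rewrite /consistent -cats1 big_cat big_seq1 => hr_gt0.
rewrite lt_def payoff_prob_ge0 andbT.
by apply: contraTneq hr_gt0 => /= ->; rewrite mulr0 ltxx.
Qed.

End PayoffProb.

Section RockPaperScissors.
Context {R : realType} {m n : nat}.
Notation action := 'I_(m + n).
Notation game := (rps_with_duds R m n).
Implicit Types (f : {perm action}) (a b : action) (h : history R action action).

Definition dud_prob f (s : dist R action) : R := \sum_a s a * (dud f a)%:R.

Lemma dud_prob_ge0 f s : 0 <= dud_prob f s.
Proof. by apply: sumr_ge0 => a _; rewrite mulr_ge0 ?pr_ge0 ?ler0n. Qed.

Lemma dud_prob_dirac f a : dud_prob f (dirac a) = (dud f a)%:R.
Proof. exact: sum_dirac. Qed.

Lemma mean_rps_utility f a b :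
  2^-1 * rps_utility R f true a b + 2^-1 * rps_utility R f false a b =
  (dud f b)%:R - (dud f a)%:R.
Proof.
rewrite -mulrDr /rps_utility /wins.
case: (dud f a) (dud f b) => [] [] /=.
- by rewrite !subrr addr0 mulr0.
- by rewrite sub0r -opprD mulrN mulVf // (pnatr_eq0 _ 2).
- by rewrite subr0 mulVf // (pnatr_eq0 _ 2).
(* Two non-duds: flipping the coin swaps winner and loser, so the two utilities cancel. *)
- by rewrite ![_ == (f _ + 1)%N %[mod m]]eq_sym addrA subrK !subrr mulr0.
Qed.

Lemma expected_u1_rps f s t :
  expected_u1 (game f) s t = dud_prob f t - dud_prob f s.
Proof.
have -> : expected_u1 (game f) s t =
    \sum_a \sum_b s a * t b * ((dud f b)%:R - (dud f a)%:R).
  apply: eq_bigr => a _; apply: eq_bigr => b _.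
  by rewrite big_bool /= !ffunE -mean_rps_utility [RHS]mulrDr !mulrA.
rewrite /dud_prob.
under eq_bigr => a _.
  under eq_bigr => b _ do rewrite mulrBr -mulrA (mulrAC (s a)).
  rewrite sumrB -mulr_sumr -mulr_sumr pr_sum1 mulr1.
  over.
by rewrite sumrB -mulr_suml pr_sum1 mul1r.
Qed.

Lemma exists_nondud f : (0 < m)%N -> exists a, ~~ dud f a.
Proof.
move=> m_gt0; have mn_gt0 : (0 < m + n)%N by rewrite addn_gt0 m_gt0.
(* The action that [f] sends to 0, which lies below [m]. *)
by exists ((f^-1)%g (Ordinal mn_gt0)); rewrite /dud permKV -ltnNge.
Qed.

(** A fixed non-dud serves both players: as a reply of player 2 it holds every [s] to at most 0, and
    played by player 1 it secures at least 0. *)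
Lemma value_rps f : (0 < m)%N -> value (game f) = 0.
Proof.
move=> /(exists_nondud f)[a /negPf a_nondud].
have dirac_a : dud_prob f (dirac a) = 0 by rewrite dud_prob_dirac a_nondud.
have inf_le0 s : inf (range (expected_u1 (game f) s)) <= 0.
  apply: (@le_trans _ _ (expected_u1 (game f) s (dirac a))).
    apply: ge_inf; last by exists (dirac a).
    (* [ge_inf] requires the range to be bounded below. *)
    exists (- dud_prob f s) => _ [t _ <-].
    by rewrite expected_u1_rps lerDr dud_prob_ge0.
  by rewrite expected_u1_rps dirac_a sub0r oppr_le0 dud_prob_ge0.
apply/le_anti/andP; split.
  apply: ge_sup.
    by exists (inf (range (expected_u1 (game f) (dirac a)))), (dirac a).
  by move=> _ [s _ <-].
apply: (@le_trans _ _ (inf (range (expected_u1 (game f) (dirac a))))).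
  apply: lb_le_inf.
    by exists (expected_u1 (game f) (dirac a) (dirac a)), (dirac a).
  by move=> _ [t _ <-]; rewrite expected_u1_rps dirac_a subr0 dud_prob_ge0.
apply: ub_le_sup; last by exists (dirac a).
by exists 0 => _ [s _ <-].
Qed.

Lemma maximin_nondud f a : (0 < m)%N ->
  ~~ dud f a -> maximin (game f) (dirac a).
Proof.
move=> m_gt0 /negPf a_nondud t.
rewrite value_rps // expected_u1_rps dud_prob_dirac a_nondud subr0.
exact: dud_prob_ge0.
Qed.

Lemma wins_nondud f c a b : wins f c a b -> ~~ dud f a.
Proof. by rewrite /wins; case: (dud f a). Qed.

Lemma possible_payoff f a b u : 0 < payoff_prob (game f) a b u ->
  exists c, u.1 = (wins f c a b)%:R - (wins f c b a)%:R.
Proof. by case/payoff_prob_gt0 => c <-; exists c. Qed.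

Lemma decisive_learned h a b u : (0 < m)%N -> u.1 != 0 ->
  learned_enough game (rcons h (Round a b u)).
Proof.
(* The winner is read off the sign of the payoff, hence is the same action for every consistent
   [f]. *)
move=> m_gt0 u_neq0; exists (dirac (if 0 < u.1 then a else b)) => f.
move=> /consistent_rcons/possible_payoff[c /= uE].
apply: maximin_nondud => //; move: u_neq0; rewrite {}uE.
case wab: (wins f c a b); case wba: (wins f c b a); rewrite ?subrr ?eqxx //.
- by rewrite subr0 ltr01 (wins_nondud wab).
- by rewrite sub0r oppr_gt0 ltr10 (wins_nondud wba).
Qed.

(** The second conjunct carries the induction: a history that has not taught enough has cost exactly
    0, so only the last round can contribute to the loss. *)
Lemma loss_until_learned f S1 S2 h : (0 < m)%N ->
  possible (game f) S1 S2 h ->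
  (forall t, (t < size h)%N -> ~ learned_enough game (take t h)) ->
  loss (game f) h <= 1 /\ (learned_enough game h \/ loss (game f) h = 0).
Proof.
move=> m_gt0; elim=> {h} [_|h a b u _ IH _ _ u_gt0 unlearned].
  by rewrite /loss big_nil ler01; split; last right.
have [|_ [learned_h|loss_h]] := IH.
- move=> t lt_t_h; have := unlearned t.
  by rewrite size_rcons -cats1 takel_cat ?(ltnW lt_t_h) //; apply; apply: ltnW.
(* [h] is itself a proper prefix of the extended history, so it cannot have taught enough. *)
- case: (unlearned (size h)); first by rewrite size_rcons.
  by rewrite -cats1 take_size_cat.
have -> : loss (game f) (rcons h (Round a b u)) = - u.1.
  rewrite /loss -cats1 big_cat big_seq1 /= -/(loss _ _) loss_h value_rps //.
  by rewrite !add0r.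
split.
  have [c ->] := possible_payoff u_gt0; rewrite opprB.
  by rewrite -[leRHS]subr0 lerB ?ler0n ?lern1 ?leq_b1.
have [->|u_neq0] := eqVneq u.1 0; first by right; rewrite oppr0.
by left; apply: decisive_learned.
Qed.

End RockPaperScissors.

Theorem theorem4 (R : realType) (m n : nat) (hm : (2 < m)%N) :
  guaranteed_BL_WoLF_learnable (rps_with_duds R m n) 1 /\
  (n = 0%N -> guaranteed_BL_WoLF_learnable (rps_with_duds R m n) 0).
Proof.
have m_gt0 : (0 < m)%N by apply: ltn_trans hm.
have mn_gt0 : (0 < m + n)%N by rewrite addn_gt0 m_gt0.
(* The bound holds for every [S1]; always playing action 0 is an arbitrary choice. *)
split=> [|n0]; exists (fun=> dirac (Ordinal mn_gt0));
  move=> f S2 h h_possible unlearned.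
  by case: (loss_until_learned m_gt0 h_possible unlearned).
case: h => [|r h] in h_possible unlearned *; first by rewrite /loss big_nil.
(* With [n = 0] no action is a dud under any [g], so the empty history already teaches enough and no
   round is charged. *)
case: (unlearned 0%N) => //; exists (dirac (Ordinal mn_gt0)) => g _.
apply: maximin_nondud => //; rewrite /dud -ltnNge.
by apply: leq_trans (ltn_ord _) _; rewrite n0 addn0.
Qed.
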